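(* Let $\mathcal{H}$ be a finite dimensional complex Hilbert space and $X$ a measurable space. Then any $C^*$-extreme point in $\mathcal{P}_{\mathcal{H}}(X)$ is a spectral measure.
   Context: A measurable space is a nonempty set $X$ with a $\sigma$-algebra $\mathcal{O}(X)$ of subsets; all singletons are assumed measurable. $\mathcal{B}(\mathcal{H})$ denotes the bounded operators on $\mathcal{H}$; the inner product is linear in the second variable; a projection is a self-adjoint idempotent. A positive operator valued measure (POVM) on $X$ with values in $\mathcal{B}(\mathcal{H})$ is a map $\mu:\mathcal{O}(X)\to\mathcal{B}(\mathcal{H})$ with $\mu(A)\ge 0$ for all $A$ and such that for all $h,k\in\mathcal{H}$ the map $A\mapsto\langle h,\mu(A)k\rangle$ is a complex measure. It is normalized if $\mu(X)=I_{\mathcal{H}}$, and it is a spectral measure if it is normalized and every $\mu(A)$ is a projection. $\mathcal{P}_{\mathcal{H}}(X)$ is the set of all normalized POVMs on $X$ with values in $\mathcal{B}(\mathcal{H})$. A normalized POVM $\mu$ is a $C^*$-extreme point in $\mathcal{P}_{\mathcal{H}}(X)$ if, whenever $\mu(\cdot)=\sum_{i=1}^n T_i^*\mu_i(\cdot)T_i$ with $\mu_i\in\mathcal{P}_{\mathcal{H}}(X)$ and invertible $T_i\in\mathcal{B}(\mathcal{H})$ satisfying $\sum_{i=1}^n T_i^*T_i=I_{\mathcal{H}}$, there are unitaries $U_i\in\mathcal{B}(\mathcal{H})$ such that $\mu_i(\cdot)=U_i^*\mu(\cdot)U_i$ for $1\le i\le n$. *)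

(* Defs.v *)
From HB Require Import structures.
From mathcomp Require Import all_boot all_order all_algebra sesquilinear.
From mathcomp.real_closed Require Import complex.
From mathcomp Require Import all_classical all_reals all_analysis.

Set Implicit Arguments.
Unset Strict Implicit.
Unset Printing Implicit Defensive.

Import Order.TTheory GRing.Theory Num.Theory.
Import numFieldNormedType.Exports.

Local Open Scope classical_set_scope.
Local Open Scope ring_scope.

(* A finite dimensional complex Hilbert space is a vectType H over R[i] together
   with a positive definite hermitian form ip : {dot H for Num.conj}; it is
   automatically complete, and every linear endomorphism is bounded, so that
   B(H) is 'End(H). *)

Section Operators.
Variables (C : numClosedFieldType) (H : vectType C).
Variable ip : {dot H for Num.conj}.

(* MathComp's forms are linear in the first variable; the arguments are swapped
   to get an inner product that is linear in the second one. *)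
Definition inner (h k : H) : C := ip k h.

Definition is_adjoint (T S : 'End(H)) : Prop :=
  forall h k, inner (T h) k = inner h (S k).

Lemma inner_inj (u v : H) : (forall h, inner h u = inner h v) -> u = v.
Proof.
move=> uv; apply/eqP; rewrite -subr_eq0 -(dnorm_eq0 ip).
by rewrite linearBl subr_eq0; apply/eqP/uv.
Qed.

Lemma adjoint_unique (T S S' : 'End(H)) :
  is_adjoint T S -> is_adjoint T S' -> S = S'.
Proof.
move=> TS TS'; apply/lfunP => k; apply: inner_inj => h.
by rewrite -TS -TS'.
Qed.

Definition basis_coords (f : 'End(H)) (h : H) : 'rV[C]_(\dim {:H}) :=
  \row_j ip h (f (vbasis {:H})`_j).

Lemma basis_coords_linear f : linear (basis_coords f).
Proof.
by move=> a u v; apply/rowP => j; rewrite !mxE linearDl linearZl_LR.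
Qed.

HB.instance Definition _ f :=
  GRing.isLinear.Build C H 'rV[C]_(\dim {:H}) _ (basis_coords f)
    (basis_coords_linear f).

Lemma inner_basis (f : 'End(H)) (u v : H) :
  (forall j : 'I_(\dim {:H}),
     ip u (vbasis {:H})`_j = ip v (f (vbasis {:H})`_j)) ->
  forall h, ip u h = ip v (f h).
Proof.
move=> uv h; rewrite (coord_vbasis (memvf h)).
rewrite !(linear_sum, linear_sumr) /=; apply: eq_bigr => j _.
by rewrite !linearZ /= uv.
Qed.

Lemma adjoint_exists (T : 'End(H)) : exists S, is_adjoint T S.
Proof.
pose Phi : 'Hom(H, 'rV[C]_(\dim {:H})) := linfun (basis_coords \1%VF).
pose Psi : 'Hom(H, 'rV[C]_(\dim {:H})) := linfun (basis_coords T).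
have kerPhi : lker Phi == 0%VS.
  apply/lker0P => u v; rewrite !lfunE => /rowP uv.
  apply: inner_inj => h; rewrite /inner.
  rewrite (inner_basis (f := \1%VF) (v := v)) ?lfunE //= => j.
  by have := uv j; rewrite !mxE !lfunE.
have imPhi : limg Phi = fullv.
  apply/eqP; rewrite eqEdim subvf /= limg_dim_eq ?(eqP kerPhi) ?capv0 //.
  by rewrite !dimvf /dim /= mul1n.
exists ((Phi^-1)%VF \o Psi)%VF => h k; rewrite /inner.
apply/esym; rewrite comp_lfunE; apply: inner_basis => j.
have /rowP/(_ j) : Phi (Phi^-1%VF (Psi k)) = Psi k.
  by rewrite limg_lfunVK // imPhi memvf.
by rewrite !lfunE !mxE !lfunE.
Qed.

Definition adjoint (T : 'End(H)) : 'End(H) := sval (cid (adjoint_exists T)).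

Lemma adjointP (T : 'End(H)) : is_adjoint T (adjoint T).
Proof. exact: (svalP (cid (adjoint_exists T))). Qed.

Definition positive_op (T : 'End(H)) : Prop := forall h, 0 <= inner h (T h).

Definition projection_op (P : 'End(H)) : Prop :=
  adjoint P = P /\ (P \o P)%VF = P.

Definition invertible_op (T : 'End(H)) : Prop :=
  exists S : 'End(H), (S \o T)%VF = \1%VF /\ (T \o S)%VF = \1%VF.

Definition unitary_op (U : 'End(H)) : Prop :=
  (adjoint U \o U)%VF = \1%VF /\ (U \o adjoint U)%VF = \1%VF.

End Operators.

(* Maps on the sigma-algebra are represented by functions on all of set X; only
   their values on measurable sets are ever constrained or compared. *)

Section POVM.
Variables (R : realType) (H : vectType R[i]) (ip : {dot H for Num.conj}).
Variables (d : measure_display) (X : measurableType d).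

(* R[i]^o is R[i] seen as a normed module over itself, with the topology of the
   modulus. *)
Definition complex_measure (nu : set X -> R[i]) : Prop :=
  nu set0 = 0 /\
  forall F : (set X)^nat, (forall j, measurable (F j)) -> trivIset setT F ->
    series (fun j => nu (F j)) @ \oo --> (nu (\bigcup_j F j) : R[i]^o).

Definition povm (mu : set X -> 'End(H)) : Prop :=
  (forall A, measurable A -> positive_op ip (mu A)) /\
  (forall h k : H, complex_measure (fun A => inner ip h (mu A k))).

Definition normalized_povm (mu : set X -> 'End(H)) : Prop :=
  povm mu /\ mu setT = \1%VF.

Definition spectral_measure (mu : set X -> 'End(H)) : Prop :=
  normalized_povm mu /\ (forall A, measurable A -> projection_op ip (mu A)).

Definition cstar_extreme (mu : set X -> 'End(H)) : Prop :=
  normalized_povm mu /\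
  forall (n : nat) (nu : 'I_n -> set X -> 'End(H)) (T : 'I_n -> 'End(H)),
    (forall i, normalized_povm (nu i)) ->
    (forall i, invertible_op (T i)) ->
    \sum_(i < n) (adjoint ip (T i) \o T i)%VF = \1%VF ->
    (forall A, measurable A ->
       mu A = \sum_(i < n) (adjoint ip (T i) \o nu i A \o T i)%VF) ->
    exists U : 'I_n -> 'End(H), forall i,
      unitary_op ip (U i) /\
      forall A, measurable A -> nu i A = (adjoint ip (U i) \o mu A \o U i)%VF.

End POVM.

(* Main.v *)
Require Import Defs.
From HB Require Import structures.
From mathcomp Require Import all_boot all_order all_algebra sesquilinear.
From mathcomp.real_closed Require Import complex.
From mathcomp Require Import all_classical all_reals all_analysis.

(** Fix a measurable set A and put E = mu A, so that 0 <= E <= 1.  Splitting X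
    into A and its complement writes mu as the sum of two unnormalized POVMs,
    the tilts: one weighs A by 2/3 and the complement by 1/3, the other does
    the opposite.  The first has total mass P = (1 + E) / 3, which is positive
    definite, hence P = T^* T with T invertible ([positive_op_factor]), and
    N(.) = (T^-1)^* tilt(.) T^-1 is a normalized POVM ([tilt_normalize]).  The
    same holds for the second tilt, so the two make up a C*-convex combination
    with sum mu, and C*-extremality gives N(A) = U^* E U with U unitary.

    Up to a unitary, N(A) is the function g(E) with g(t) = 2t / (1 + t), and
    g(t) > t for 0 < t < 1.  As E and N(A) have the same trace, E can have no
    eigenvalue in the open interval (0, 1), that is, E is a projection.  The
    argument is carried out without eigenvalues ([effect_idempotent]): by
    cyclicity of the trace, tr N(A) = tr E amounts to
    tr ((T^-1)^* (E - E^2) T^-1) = 0.  The operator under the trace is positive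
    because E - E^2 = E (1 - E) E + (1 - E) E (1 - E); a positive operator of
    trace zero vanishes, whence E = E^2. *)

Set Implicit Arguments.
Unset Strict Implicit.
Unset Printing Implicit Defensive.

Import Order.TTheory GRing.Theory Num.Theory.
Import numFieldNormedType.Exports.

Local Open Scope classical_set_scope.
Local Open Scope ring_scope.

(** * Orthonormal bases and the trace *)

Section OrthonormalBases.
Variables (C : numClosedFieldType) (H : vectType C).
Variable ip : {dot H for Num.conj}.

Definition orthonormal_basis (e : seq H) : Prop :=
  orthonormal ip e /\ basis_of {:H} e.

Lemma dnorm_normalize (u : H) : u != 0 ->
  let v := (sqrtC (ip u u))^-1 *: u in ip v v = 1.
Proof.
move=> u0 v; rewrite dnormZ normfV ger0_norm ?sqrt_dnorm_ge0 // exprVn sqrtCK.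
by rewrite mulVf // dnorm_eq0.
Qed.

(** Gram-Schmidt, one vector at a time: while the family does not span the
    space, the component orthogonal to it of a missing vector is nonzero and
    can be normalized. *)
Lemma orthonormal_extend (s : seq H) :
  orthonormal ip s -> exists2 e, orthonormal_basis e & {subset s <= e}.
Proof.
(* induction on a bound for the number of missing vectors *)
move: {2}(\dim {:H} - size s)%N (leqnn (\dim {:H} - size s)%N) => n.
elim: n s => [|n IHn] s; rewrite ?leqn0 ?subn_eq0.
  move=> dims ons; exists s => //; split=> //.
  by rewrite basisEfree (orthonormal_free ons) subvf.
move=> dims ons; have [ful|] := boolP (\dim {:H} <= size s)%N.
  by apply: IHn => //; move: ful; rewrite -subn_eq0 => /eqP->.
rewrite -ltnNge => ltsd.
have [v vs] : exists v, v \notin << s >>%VS.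
  apply: contrapT => /forallNP sall; move: ltsd; rewrite ltnNge => /negP; apply.
  apply: leq_trans (dim_span s); apply: dimvS; apply/subvP => v _.
  by have /negP := sall v; rewrite negbK.
have [x xs [y [vE _ oys]]] := orthogonal_split ip s v.
have y0 : y != 0.
  by apply: contraNneq vs => y0; rewrite vE y0 addr0.
pose z := (sqrtC (ip y y))^-1 *: y.
have zz : ip z z = 1 by exact: dnorm_normalize.
have onzs : orthonormal ip (z :: s).
  rewrite -cat1s orthonormal_cat ons /= /orthonormal /= zz eqxx /=.
  by apply/orthoPl => w ws; rewrite linearZl_LR /= (orthoPl oys w ws) mulr0.
have [||e one se] := IHn (z :: s); rewrite //=.
  by rewrite subnS; case: (_ - _)%N dims.
by exists e => // w ws; apply: se; rewrite inE ws orbT.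
Qed.

Lemma orthonormal_basis_size e : orthonormal_basis e -> size e = \dim {:H}.
Proof. by case=> _ /andP[/eqP <- /eqnP->]. Qed.

Lemma orthonormal_nth e i j : orthonormal ip e -> (i < size e)%N ->
  (j < size e)%N -> ip e`_i e`_j = (i == j)%:R.
Proof.
move=> /orthonormalP[ue one] ie je.
by rewrite one ?mem_nth // nth_uniq.
Qed.

Lemma orthonormal_expand e v :
  orthonormal_basis e -> v = \sum_(x <- e) ip v x *: x.
Proof.
move=> [one be].
rewrite {1}(@coord_basis _ _ _ _ (in_tuple e) v be) ?memvf //.
rewrite [RHS](big_nth 0) big_mkord; apply: eq_bigr => i _; congr (_ *: _).
rewrite {2}(@coord_basis _ _ _ _ (in_tuple e) v be) ?memvf //.
rewrite linear_sumlz (bigD1 i) //= linearZl_LR /= orthonormal_nth // eqxx mulr1.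
rewrite big1 ?addr0 // => j ji.
by rewrite linearZl_LR /= orthonormal_nth // (inj_eq val_inj) (negPf ji) mulr0.
Qed.

Lemma parseval e u v : orthonormal_basis e ->
  ip u v = \sum_(x <- e) ip u x * (ip v x)^*.
Proof.
move=> one; rewrite {1}(orthonormal_expand v one) linear_sumr.
by apply: eq_bigr => x _; rewrite linearZ /= mulrC.
Qed.

Definition trace (e : seq H) (f : 'End(H)) : C := \sum_(x <- e) ip (f x) x.

(** Both sides expand to the same double sum over pairs of basis vectors. *)
Lemma traceC e f g : orthonormal_basis e ->
  trace e (f \o g)%VF = trace e (g \o f)%VF.
Proof.
move=> one.
have tr2 (p q : 'End(H)) :
    trace e (p \o q)%VF = \sum_(x <- e) \sum_(y <- e) ip (q x) y * ip (p y) x.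
  apply: eq_bigr => x _; rewrite comp_lfunE.
  rewrite {1}(orthonormal_expand (q x) one) linear_sum linear_sumlz.
  by apply: eq_bigr => y _; rewrite linearZ linearZl_LR.
rewrite !tr2 exchange_big; apply: eq_bigr => x _.
by apply: eq_bigr => y _; rewrite mulrC.
Qed.

(** Polarization, which is special to complex scalars: replacing [v] by
    ['i *: v] separates [ip (f u) v] from [ip (f v) u]. *)
Lemma op_eq0 (f : 'End(H)) : (forall h, ip (f h) h = 0) -> f = 0.
Proof.
move=> f0; apply/lfunP => u; rewrite lfunE /=; apply/eqP.
rewrite -(dnorm_eq0 ip); set v := {2}(f u); apply/eqP.
have pol w : ip (f u) w + ip (f w) u = 0.
  have := f0 (u + w); rewrite [f _]linearD linearDl !linearD /= !f0.
  by rewrite add0r addr0 addrC.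
have := pol ('i *: v); rewrite !linearZ linearZl_LR /= conjCi mulNr.
move=> /eqP; rewrite addrC subr_eq0 => /eqP/(mulfI (neq0Ci C)) vE.
have := pol v; rewrite vE -mulr2n => /eqP.
by rewrite mulrn_eq0 /= => /eqP.
Qed.

(** In any orthonormal basis the trace of [Q] is a sum of nonnegative terms, so
    each of them vanishes; as every unit vector belongs to some orthonormal
    basis, the quadratic form of [Q] is zero. *)
Lemma positive_trace0 (Q : 'End(H)) : positive_op ip Q ->
  (forall e, orthonormal_basis e -> trace e Q = 0) -> Q = 0.
Proof.
move=> Q0 trQ; apply: op_eq0 => h.
have [->|h0] := eqVneq h 0; first by rewrite linear0r.
pose z := (sqrtC (ip h h))^-1 *: h.
have zz : ip z z = 1 by exact: dnorm_normalize.
have [|e one ze] := @orthonormal_extend [:: z].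
  by rewrite /orthonormal /= zz eqxx.
have /eqP := trQ e one; rewrite psumr_eq0; last by move=> x _; exact: Q0.
have zine : z \in e by rewrite ze // inE.
move=> /allP/(_ z zine)/=.
rewrite /z [Q _]linearZ linearZl_LR linearZ /= !mulf_eq0 conjC_eq0 invr_eq0.
by rewrite sqrt_dnorm_eq0 (negPf h0) /= => /eqP.
Qed.

Lemma adjointE (T : 'End(H)) u v : ip (adjoint ip T u) v = ip u (T v).
Proof. by have := adjointP ip T v u; rewrite /inner => ->. Qed.

Lemma positive_op_selfadjoint (T : 'End(H)) : positive_op ip T ->
  forall u v, ip (T u) v = ip u (T v).
Proof.
move=> T0 u v; suff TA : adjoint ip T = T by rewrite -{1}TA adjointE.
apply/esym/eqP; rewrite -subr_eq0; apply/eqP/op_eq0 => h.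
rewrite !lfunE /= lfunE linearBl /= adjointE.
rewrite [X in _ - X]hermC /= expr0 mul1r (CrealP _) ?subrr //.
by apply: ger0_real; exact: T0.
Qed.

End OrthonormalBases.

(** * Factorization of positive definite operators *)

Section Factorization.
Variables (C : numClosedFieldType) (H : vectType C).
Variable ip : {dot H for Num.conj}.

(** [P] defines a second inner product [G u v = ip u (P v)].  The linear map [T]
    sending a [G]-orthonormal basis [f] to an [ip]-orthonormal basis [e]
    satisfies [ip (T u) (T v) = G u v], which is [T^* T = P]. *)
Lemma positive_op_factor (P : 'End(H)) : positive_op ip P ->
  (forall h, inner ip h (P h) = 0 -> h = 0) ->
  exists2 T : 'End(H), (adjoint ip T \o T)%VF = P & invertible_op T.
Proof.
move=> P0 Pinj.
pose F : H -> H -> C := fun u v => ip u (P v).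
have Fl : bilinear_for *%R (Num.conj \; *%R) F.
  split=> [u a x y|u a x y] /=; rewrite /F.
    by rewrite linearPl.
  by rewrite !linearP.
have Fh x y : F x y = (-1) ^+ false * (F y x)^*.
  by rewrite /F expr0 mul1r -positive_op_selfadjoint // hermC expr0 mul1r.
have Fp u : u != 0 -> 0 < F u u.
  move=> u0; rewrite lt_def; have := P0 u; rewrite /inner /F.
  rewrite -positive_op_selfadjoint // => ->; rewrite andbT.
  by apply: contra_neq u0; exact: Pinj.
have [G GE] : exists G : {dot H for Num.conj}, forall u v, G u v = ip u (P v).
  exists (HB.pack_for {dot H for Num.conj} F
    (bilinear_isBilinear.Build C H H C *%R (Num.conj \; *%R) F Fl)
    (isHermitianSesquilinear.Build C H false Num.conj F Fh)
    (isDotProduct.Build C H F Fp)) => //.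
have [e one _] := @orthonormal_extend C H ip [::] isT.
have [f onf _] := @orthonormal_extend C H G [::] isT.
have sz : size e = size f.
  by rewrite (orthonormal_basis_size one) (orthonormal_basis_size onf).
pose t v := \sum_(i < size e) G v f`_i *: e`_i.
have tlin : linear t.
  move=> a u v; rewrite /t scaler_sumr -big_split; apply: eq_bigr => i _ /=.
  by rewrite linearPl scalerDl scalerA.
have [T TE] : exists T : 'End(H), forall v, T v = t v.
  exists (linfun (HB.pack_for {linear H -> H} t
    (GRing.isLinear.Build C H H _ t tlin))).
  by move=> v; rewrite lfunE.
have Te v (i : 'I_(size e)) : ip (T v) e`_i = G v f`_i.
  rewrite TE /t linear_sumlz (bigD1 i) //= linearZl_LR /=.
  rewrite orthonormal_nth //; last exact: one.1.
  rewrite eqxx mulr1 big1 ?addr0 // => j ji.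
  rewrite linearZl_LR /= orthonormal_nth //; last exact: one.1.
  by rewrite (inj_eq val_inj) (negPf ji) mulr0.
have TT u v : ip (T u) (T v) = ip u (P v).
  rewrite -GE (parseval (T u) (T v) one) (parseval u v onf).
  rewrite (big_nth 0) [RHS](big_nth 0) -sz.
  by rewrite !big_mkord; apply: eq_bigr => i _; rewrite !Te.
exists T.
  apply/lfunP => v; apply: (@inner_inj _ _ ip) => u.
  by rewrite /inner comp_lfunE adjointE TT positive_op_selfadjoint.
have kT : lker T == 0%VS.
  rewrite -subv0; apply/subvP => u; rewrite memv_ker memv0 => /eqP Tu.
  apply/eqP/Pinj; rewrite /inner positive_op_selfadjoint // -TT Tu.
  exact: linear0r.
by exists (T^-1)%VF; rewrite lker0_compVf ?lker0_compfV.
Qed.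
End Factorization.

(** * Effects with the trace of their tilt *)

Section Effects.
Variables (C : numClosedFieldType) (H : vectType C).
Variable ip : {dot H for Num.conj}.

Lemma inner_op_inj (f g : 'End(H)) :
  (forall h k, inner ip h (f k) = inner ip h (g k)) -> f = g.
Proof.
by move=> fg; apply/lfunP => k; apply: (@inner_inj _ _ ip) => h; exact: fg.
Qed.

Lemma adjoint_comp (f g : 'End(H)) :
  adjoint ip (f \o g)%VF = (adjoint ip g \o adjoint ip f)%VF.
Proof.
apply: inner_op_inj => h k; rewrite /inner comp_lfunE !adjointE.
by rewrite comp_lfunE.
Qed.

Lemma adjoint1 : adjoint ip \1%VF = \1%VF.
Proof. by apply: inner_op_inj => h k; rewrite /inner adjointE !lfunE. Qed.

Lemma trace_scaleB e c (f g : 'End(H)) :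
  trace ip e (c *: (f - g)) = c * (trace ip e f - trace ip e g).
Proof.
rewrite /trace mulrBr !mulr_sumr -sumrB; apply: eq_bigr => x _.
by rewrite scale_lfunE linearZl_LR add_lfunE opp_lfunE linearBl mulrBr.
Qed.

(** The hypotheses say that [N] is [2 E / (1 + E)] up to the unitary factor of
    the polar decomposition of [T], and [N] has the trace of [E]. *)
Lemma effect_idempotent (E T N U : 'End(H)) :
  positive_op ip E -> positive_op ip (\1%VF - E) -> invertible_op T ->
  (adjoint ip T \o T)%VF = 3^-1 *: (\1%VF + E) ->
  (adjoint ip T \o N \o T)%VF = (2 * 3^-1) *: E ->
  unitary_op ip U -> N = (adjoint ip U \o E \o U)%VF ->
  (E \o E)%VF = E.
Proof.
move=> E0 F0 [S [ST TS]] TT TNT [_ UU] NE.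
have Esa := positive_op_selfadjoint E0.
have Fsa := positive_op_selfadjoint F0.
have three : (3 : C) != 0 by rewrite pnatr_eq0.
have TS' : (adjoint ip T \o adjoint ip S)%VF = \1%VF.
  by rewrite -adjoint_comp ST adjoint1.
have ST' : (adjoint ip S \o adjoint ip T)%VF = \1%VF.
  by rewrite -adjoint_comp TS adjoint1.
pose Q := (adjoint ip S \o (E - (E \o E)) \o S)%VF.
have Q0 : positive_op ip Q.
  move=> h; rewrite /inner /Q !comp_lfunE adjointE; set k := S h.
  have -> : (E - (E \o E))%VF = 
    ((E \o ((\1 - E) \o E)) + ((\1 - E) \o (E \o (\1 - E))))%VF.
    apply/lfunP => v.
    rewrite !(add_lfunE, opp_lfunE, comp_lfunE, id_lfunE, linearB) /=.
    by rewrite opprK [- _ + _]addrC addrCA subrKA subrr addr0.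
  rewrite add_lfunE linearDl /= !comp_lfunE Esa [X in _ + X]Fsa.
  by rewrite addr_ge0 //; [exact: F0|exact: E0].
have trN e : orthonormal_basis ip e -> trace ip e N = trace ip e E.
  by move=> one; rewrite NE -comp_lfunA traceC // -comp_lfunA UU comp_lfun1r.
have NS : (adjoint ip S \o E \o S)%VF = (3 / 2) *: N.
  rewrite -[N]comp_lfun1r -TS -[N]comp_lfun1l -ST' comp_lfunA.
  have -> : (adjoint ip S \o adjoint ip T \o N \o T \o S =
             adjoint ip S \o (adjoint ip T \o N \o T) \o S)%VF.
    by rewrite !comp_lfunA.
  rewrite TNT -comp_lfunZr -comp_lfunZl scalerA mulrA divfK ?mulfV ?scale1r //.
(* the second term on the right has the trace of E, by cyclicity *)
have QE : Q = 3 *: (N - (adjoint ip S \o (E \o adjoint ip T)))%VF.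
  have EE : (E - (E \o E) = 2 *: E - 3 *: (E \o (adjoint ip T \o T)))%VF.
    rewrite TT -comp_lfunZr scalerA mulfV // scale1r comp_lfunDr comp_lfun1r.
    by rewrite scaler_nat mulr2n opprD addrA addrK.
  rewrite /Q EE comp_lfunDr comp_lfunDl comp_lfunNr comp_lfunNl.
  rewrite -!comp_lfunZr -!comp_lfunZl NS scalerA mulrCA mulfV ?pnatr_eq0 //.
  rewrite mulr1 scalerBr; congr (_ - _ *: _).
  by rewrite -!comp_lfunA TS comp_lfun1r.
have Q_eq0 : Q = 0.
  apply: (positive_trace0 Q0) => e one; rewrite QE trace_scaleB trN //.
  by rewrite traceC // -comp_lfunA TS' comp_lfun1r subrr mulr0.
apply/eqP; rewrite eq_sym -subr_eq0; apply/eqP.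
rewrite -[LHS]comp_lfun1r -ST -[LHS]comp_lfun1l -TS'.
have -> : ((adjoint ip T \o adjoint ip S) \o ((E - (E \o E)) \o (S \o T)) =
  adjoint ip T \o (Q \o T))%VF by rewrite /Q !comp_lfunA.
by rewrite Q_eq0 comp_lfun0l comp_lfun0r.
Qed.
End Effects.

(** * Complex measures and POVMs *)

Section ComplexMeasures.
Variables (R : realType) (d : measure_display) (X : measurableType d).
Implicit Types nu : set X -> R[i].

Lemma complex_measureD nu1 nu2 : complex_measure nu1 -> complex_measure nu2 ->
  complex_measure (fun A => nu1 A + nu2 A).
Proof.
move=> [z1 s1] [z2 s2]; split=> [|F mF tF]; first by rewrite z1 z2 addr0.
have -> : series (fun j => nu1 (F j) + nu2 (F j)) =
    series (fun j => nu1 (F j)) + series (fun j => nu2 (F j)).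
  by rewrite -seriesD.
exact: (@cvgD _ R[i]^o _ _ _ _ _ _ _ (s1 F mF tF) (s2 F mF tF)).
Qed.

Lemma complex_measureZ c nu : complex_measure nu ->
  complex_measure (fun A => c * nu A).
Proof.
move=> [z s]; split=> [|F mF tF]; first by rewrite z mulr0.
have -> : series (fun j => c * nu (F j)) =
    c \*: (series (fun j => nu (F j)) : R[i]^o ^nat).
  by apply/funext => n; rewrite /series /= -mulr_sumr.
exact: (@cvgZl_tmp _ R[i]^o _ _ _ _ _ _ (s F mF tF)).
Qed.

Lemma complex_measure_restr nu A : measurable A -> complex_measure nu ->
  complex_measure (fun B => nu (B `&` A)).
Proof.
move=> mA [z s]; split=> [|F mF tF]; first by rewrite set0I.
rewrite setI_bigcupl; apply: s; first by move=> j; exact: measurableI.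
exact: trivIset_setIr.
Qed.

(** Countable additivity applied to [A], [B], and then empty sets: the partial
    sums are constant from the second one on. *)
Lemma complex_measureU nu A B : complex_measure nu -> measurable A ->
  measurable B -> A `&` B = set0 -> nu (A `|` B) = nu A + nu B.
Proof.
move=> [z s] mA mB AB0.
have mAB j : measurable (bigcup2 A B j) by case: j => [|[|j]] /=.
have := s _ mAB; rewrite -trivIset_bigcup2 bigcup2E => /(_ AB0) cvgAB.
apply: (@cvg_unique R[i]^o (@norm_hausdorff _ _) _ _ _ _ cvgAB).
apply: (@cvg_near_cst _ R[i]^o); exists 2%N => // n /= n2.
rewrite -(subnK n2) /series /= addn2 big_nat_recl // big_nat_recl //= addrA.
by rewrite big1 ?addr0 // => i _; rewrite /bigcup2 /= z.
Qed.
End ComplexMeasures.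

Section POVMs.
Variables (R : realType) (H : vectType R[i]) (ip : {dot H for Num.conj}).
Variables (d : measure_display) (X : measurableType d).
Implicit Types mu nu : set X -> 'End(H).

Lemma povmU mu A B : povm ip mu -> measurable A -> measurable B ->
  A `&` B = set0 -> mu (A `|` B) = mu A + mu B.
Proof.
move=> [_ cm] mA mB AB0; apply: (@inner_op_inj _ _ ip) => h k.
rewrite (complex_measureU (cm h k) mA mB AB0).
by rewrite /inner add_lfunE linearDl.
Qed.

Lemma povm_set0 mu : povm ip mu -> mu set0 = 0.
Proof.
move=> [_ cm]; apply: (@inner_op_inj _ _ ip) => h k.
by rewrite (cm h k).1 /inner zero_lfunE linear0l.
Qed.

Lemma povmD mu nu : povm ip mu -> povm ip nu -> povm ip (fun A => mu A + nu A).
Proof.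
move=> [p1 c1] [p2 c2]; split=> [A mA h|h k].
  by rewrite /inner add_lfunE linearDl addr_ge0 //; [exact: p1|exact: p2].
have := complex_measureD (c1 h k) (c2 h k).
congr complex_measure; apply/funext => A.
by rewrite /inner add_lfunE linearDl.
Qed.

Lemma povmZ c mu : 0 <= c -> povm ip mu -> povm ip (fun A => c *: mu A).
Proof.
move=> c0 [p1 c1]; split=> [A mA h|h k].
  by rewrite /inner scale_lfunE linearZl_LR mulr_ge0 //; exact: p1.
have := complex_measureZ c (c1 h k).
congr complex_measure; apply/funext => A.
by rewrite /inner scale_lfunE linearZl_LR.
Qed.

Lemma povm_restr mu A : measurable A -> povm ip mu ->
  povm ip (fun B => mu (B `&` A)).
Proof.
move=> mA [p1 c1]; split=> [B mB|h k]; first by apply: p1; exact: measurableI.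
exact: complex_measure_restr mA (c1 h k).
Qed.

Lemma povm_conj mu (S : 'End(H)) : povm ip mu ->
  povm ip (fun A => adjoint ip S \o mu A \o S)%VF.
Proof.
move=> [p1 c1]; have E A h k : inner ip h ((adjoint ip S \o mu A \o S)%VF k) =
    inner ip (S h) (mu A (S k)) by rewrite /inner !comp_lfunE adjointE.
split=> [A mA h|h k]; first by rewrite E; exact: p1.
by have := c1 (S h) (S k); congr complex_measure; apply/funext => A; rewrite E.
Qed.

(** Writing [nu setT = T^* T], the POVM [(T^-1)^* nu(.) T^-1] has total mass
    the identity. *)
Lemma povm_normalize nu : povm ip nu ->
  (forall h, inner ip h (nu setT h) = 0 -> h = 0) ->
  exists nu' (T : 'End(H)), [/\ normalized_povm ip nu', invertible_op T,
    (adjoint ip T \o T)%VF = nu setT &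
    forall B, nu B = (adjoint ip T \o nu' B \o T)%VF].
Proof.
move=> pnu inj.
have [T TT [S [ST TS]]] := positive_op_factor (pnu.1 _ measurableT) inj.
have TS' : (adjoint ip T \o adjoint ip S)%VF = \1%VF.
  by rewrite -adjoint_comp ST adjoint1.
have ST' : (adjoint ip S \o adjoint ip T)%VF = \1%VF.
  by rewrite -adjoint_comp TS adjoint1.
exists (fun A => adjoint ip S \o nu A \o S)%VF, T; split.
- split; first exact: povm_conj.
  by rewrite -TT !comp_lfunA ST' comp_lfun1l TS.
- by exists S.
- exact: TT.
- move=> B; rewrite !comp_lfunA TS' comp_lfun1l -comp_lfunA ST.
  by rewrite comp_lfun1r.
Qed.

(** The POVM with density 2/3 on [A] and 1/3 on its complement; any pair of
    distinct positive weights with sum 1 would serve, as then [tilt mu A] and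
    [tilt mu (~` A)] add up to [mu]. *)
Definition tilt mu A : set X -> 'End(H) :=
  fun B => (2 * 3^-1) *: mu (B `&` A) + 3^-1 *: mu (B `&` ~` A).

Lemma povm_split mu A B : povm ip mu -> measurable A -> measurable B ->
  mu (B `&` A) + mu (B `&` ~` A) = mu B.
Proof.
move=> pmu mA mB; rewrite -(povmU pmu); first by rewrite -setIUr setUCr setIT.
- exact: measurableI.
- by apply: measurableI => //; exact: measurableC.
- by rewrite setIACA setICr setI0.
Qed.

Lemma tilt_compl mu A B : povm ip mu -> measurable A -> measurable B ->
  tilt mu A B + tilt mu (~` A) B = mu B.
Proof.
move=> pmu mA mB; have third : 2 * 3^-1 + 3^-1 = 1 :> R[i].
  by rewrite -{2}[3^-1]mul1r -mulrDl natr1 mulfV // pnatr_eq0.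
rewrite /tilt setCK [X in _ + X]addrC addrACA -!scalerDl.
by rewrite [3^-1 + _]addrC third !scale1r povm_split.
Qed.

Lemma normalized_povmC mu A : normalized_povm ip mu -> measurable A ->
  mu (~` A) = \1%VF - mu A.
Proof.
move=> [pmu mu1] mA; rewrite -mu1 -(povm_split pmu mA measurableT) !setTI.
by rewrite addrAC subrr add0r.
Qed.

Lemma tilt_setT mu A : normalized_povm ip mu -> measurable A ->
  tilt mu A setT = 3^-1 *: (\1%VF + mu A).
Proof.
move=> nmu mA; rewrite /tilt !setTI normalized_povmC //.
rewrite mulrC -scalerA -scalerDr; congr (_ *: _).
by rewrite scaler_nat mulr2n addrACA subrr addr0 addrC.
Qed.

Lemma tilt_self mu A : povm ip mu -> tilt mu A A = (2 * 3^-1) *: mu A.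
Proof.
by move=> pmu; rewrite /tilt setIid setICr povm_set0 // scaler0 addr0.
Qed.

Lemma tilt_normalize mu A : normalized_povm ip mu -> measurable A ->
  exists nu' (T : 'End(H)), [/\ normalized_povm ip nu', invertible_op T,
    (adjoint ip T \o T)%VF = tilt mu A setT &
    forall B, tilt mu A B = (adjoint ip T \o nu' B \o T)%VF].
Proof.
move=> [pmu mu1] mA; have mAC := measurableC mA.
have r0 : 0 <= 3^-1 :> R[i] by rewrite invr_ge0.
apply: povm_normalize => [|h].
  have r2 : 0 <= 2 * 3^-1 :> R[i] by rewrite mulr_ge0.
  exact: (povmD (povmZ r2 (povm_restr mA pmu)) (povmZ r0 (povm_restr mAC pmu))).
(* the total mass (1 + E) / 3 is at least 1 / 3 *)
rewrite tilt_setT // /inner scale_lfunE linearZl_LR add_lfunE linearDl id_lfunE.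
move=> /eqP /=; rewrite mulf_eq0 invr_eq0 pnatr_eq0 /= paddr_eq0.
- by rewrite dnorm_eq0 => /andP[/eqP].
- exact: dnorm_ge0.
- exact: pmu.1.
Qed.

End POVMs.

Theorem theorem3p13 (R : realType)
    (H : vectType R[i]) (ip : {dot H for Num.conj})
    (d : measure_display) (X : measurableType d)
    (measurable_singleton : forall x : X, measurable [set x])
    (mu : set X -> 'End(H)) :
  cstar_extreme ip mu -> spectral_measure ip mu.
Proof.
move=> [nmu ext]; split=> // A mA; have [pmu mu1] := nmu.
have mAC := measurableC mA.
have [nu1 [T1 [nnu1 iT1 TT1 E1]]] := tilt_normalize nmu mA.
have [nu2 [T2 [nnu2 iT2 TT2 E2]]] := tilt_normalize nmu mAC.
pose nu (i : 'I_2) := if i == ord0 then nu1 else nu2.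
pose T (i : 'I_2) := if i == ord0 then T1 else T2.
have [||||U] := ext 2%N nu T.
- by move=> i; rewrite /nu; case: ifP.
- by move=> i; rewrite /T; case: ifP.
- rewrite !big_ord_recl big_ord0 addr0 /T /= TT1 TT2.
  by rewrite (tilt_compl pmu mA measurableT).
- move=> B mB; rewrite !big_ord_recl big_ord0 addr0 /T /nu /= -E1 -E2.
  by rewrite (tilt_compl pmu mA mB).
move=> /(_ ord0)[UU /(_ A mA)]; rewrite /nu /= => nuE.
have EE : (mu A \o mu A)%VF = mu A.
  apply: (effect_idempotent _ _ iT1 _ _ UU nuE).
  - exact: pmu.1.
  - by rewrite -(normalized_povmC nmu mA); exact: pmu.1.
  - by rewrite TT1 (tilt_setT nmu mA).
  - by rewrite -E1 (tilt_self A pmu).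
split=> //.
apply: (@inner_op_inj _ _ ip) => h k.
by rewrite /inner adjointE positive_op_selfadjoint //; exact: pmu.1.
Qed.
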